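(* Let $n = 2k \geq 6$ be even. There is no schedule for an asynchronous single round-robin tournament with $n$ teams that simultaneously has guaranteed rest time $k-2$, games-played difference index $1$, and rest difference index $1$.
   Context: An asynchronous single round-robin tournament with $n$ teams is one in which every pair of distinct teams plays exactly once and no two games are simultaneous; a schedule is a linear ordering of the $\binom{n}{2}$ games. The guaranteed rest time of a schedule is the maximum integer $b$ such that any two games involving the same team are separated by at least $b$ games not involving that team. The games-played difference index is the minimum integer $p$ such that at every point in the schedule, the numbers of games played so far by any two teams differ by at most $p$. The rest difference index is the minimum integer $d$ such that for every game, if one of its teams has not played in $i_1$ consecutive games since its last game and the other in $i_2$ consecutive games since its last game, then $|i_1-i_2|\le d$; for a team playing its first game, all teams are deemed to have played in an imaginary game placed immediately before the first game of the schedule. *)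

(* Defs.v *)
From mathcomp Require Import all_boot all_order all_algebra.
Set Implicit Arguments.
Unset Strict Implicit.
Unset Printing Implicit Defensive.

Definition is_maximum (P : nat -> Prop) (m : nat) : Prop :=
  P m /\ forall m', P m' -> m' <= m.

Definition is_minimum (P : nat -> Prop) (m : nat) : Prop :=
  P m /\ forall m', P m' -> m <= m'.

Section Tournament.
Variable n : nat.

(* A game is the two-element set of the teams that play it. *)
Definition is_schedule (s : seq {set 'I_n}) : Prop :=
  uniq s /\ forall g : {set 'I_n}, (g \in s) = (#|g| == 2).

Definition games_between (s : seq {set 'I_n}) (i j : nat) : seq {set 'I_n} :=
  drop i.+1 (take j s).

Definition rests_at_least (s : seq {set 'I_n}) (b : nat) : Prop :=
  forall (x : 'I_n) (i j : nat), i < j < size s ->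
    x \in nth set0 s i -> x \in nth set0 s j ->
    b <= count (fun g : {set 'I_n} => x \notin g) (games_between s i j).

Definition guaranteed_rest_time (s : seq {set 'I_n}) : nat -> Prop :=
  is_maximum (rests_at_least s).

Definition games_played (s : seq {set 'I_n}) (t : nat) (x : 'I_n) : nat :=
  count (fun g : {set 'I_n} => x \in g) (take t s).

Definition games_played_differ_at_most (s : seq {set 'I_n}) (p : nat) : Prop :=
  forall (t : nat) (x y : 'I_n), t <= size s ->
    `|games_played s t x - games_played s t y|%N <= p.

Definition games_played_difference_index (s : seq {set 'I_n}) : nat -> Prop :=
  is_minimum (games_played_differ_at_most s).

(* [setT] is the imaginary game, involving every team, that is placed before
   the first game; so a team that has not played yet has waited [j] games. *)
Definition rest_before (s : seq {set 'I_n}) (j : nat) (x : 'I_n) : nat :=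
  find (fun g : {set 'I_n} => x \in g) (rev ([set: 'I_n] :: take j s)).

Definition rests_differ_at_most (s : seq {set 'I_n}) (d : nat) : Prop :=
  forall (j : nat) (x y : 'I_n), j < size s ->
    x \in nth set0 s j -> y \in nth set0 s j ->
    `|rest_before s j x - rest_before s j y|%N <= d.

Definition rest_difference_index (s : seq {set 'I_n}) : nat -> Prop :=
  is_minimum (rests_differ_at_most s).

End Tournament.

(* Main.v *)
Require Import Defs.
From mathcomp Require Import all_boot all_order all_algebra.
From mathcomp Require Import zify.

(** Since the numbers of games played never differ by more than one, the
    schedule splits into rounds of [k] consecutive games, each of which is a
    perfect matching.  The guaranteed rest time says that a team moves
    forward by at most one position from a round to the next, and the rest
    difference index says that two opponents occupied adjacent positions in
    the preceding round (not the same position, as games are not repeated).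
    Hence both teams of the first game of a round next meet the two teams of
    its second game, and the four teams of the first two games of a round are
    again the teams of the first two games of the following round.  Over four
    rounds these four teams would play eight distinct games, while they only
    form six pairs. *)

Set Implicit Arguments.
Unset Strict Implicit.
Unset Printing Implicit Defensive.

(** * Positions in four consecutive rounds; game [r * k + i] has position [i] in round [r] *)

Section FourRounds.

Variables (T : finType) (k : nat) (g : nat -> {set T}).

Hypothesis k_ge3 : 3 <= k.
Hypothesis card_g : forall t, t < 4 * k -> #|g t| = 2.
Hypothesis g_inj : forall t u, t < 4 * k -> u < 4 * k -> g t = g u -> t = u.
Hypothesis plays_in_round : forall r x, r < 4 ->
  exists2 i, i < k & x \in g (r * k + i).
Hypothesis plays_once : forall r x i j, r < 4 -> i < k -> j < k ->
  x \in g (r * k + i) -> x \in g (r * k + j) -> i = j.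
Hypothesis moves_forward_one : forall r x i j, r < 3 -> i < k -> j < k ->
  x \in g (r * k + i) -> x \in g (r.+1 * k + j) -> i <= j.+1.
Hypothesis opponents_close : forall r x y i i' j,
  r < 3 -> i < k -> i' < k -> j < k ->
  x \in g (r * k + i) -> y \in g (r * k + i') ->
  x \in g (r.+1 * k + j) -> y \in g (r.+1 * k + j) ->
  i <= i'.+1.

Lemma index_lt r i : r < 4 -> i < k -> r * k + i < 4 * k.
Proof. by move=> r4 ik; nia. Qed.

Lemma game_eq2 t x y : t < 4 * k -> x != y -> x \in g t -> y \in g t ->
  g t = [set x; y].
Proof.
move=> tk xy xg yg; apply/esym/eqP; rewrite eqEcard card_g // cards2 xy.
by rewrite andbT subUset !sub1set xg yg.
Qed.

Lemma game_determined t u x y : t < 4 * k -> u < 4 * k -> x != y ->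
  x \in g t -> y \in g t -> x \in g u -> y \in g u -> t = u.
Proof.
move=> tk uk xy xt yt xu yu; apply: g_inj => //.
by rewrite (game_eq2 tk xy xt yt) (game_eq2 uk xy xu yu).
Qed.

Lemma game_other t x : t < 4 * k -> x \in g t -> exists2 y, x != y & y \in g t.
Proof.
move=> tk xg; have := cardsD1 x (g t); rewrite xg card_g // => -[] /esym/eqP.
case/cards1P=> y Ey; have : y \in g t :\ x by rewrite Ey set11.
by rewrite !inE eq_sym => /andP[xy yg]; exists y.
Qed.

(** Equal positions would mean that [x] and [y] already met in round [r], and no game is repeated;
    so the positions differ by exactly one. *)
Lemma opponents_adjacent r x y i i' j : r < 3 -> i < k -> i' < k -> j < k ->
  x != y -> x \in g (r * k + i) -> y \in g (r * k + i') ->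
  x \in g (r.+1 * k + j) -> y \in g (r.+1 * k + j) ->
  i' = i.+1 \/ i = i'.+1.
Proof.
move=> r3 ik i'k jk xy xi yi xj yj.
have H1 := opponents_close r3 ik i'k jk xi yi xj yj.
have H2 := opponents_close r3 i'k ik jk yi xi yj xj.
have : i <> i'.
  move=> Ei; rewrite -{}Ei in yi.
  have := game_determined (index_lt (ltnW r3) ik) (index_lt (r3 : r.+1 < 4) jk)
    xy xi yi xj yj.
  lia.
lia.
Qed.

(** Position 1 is the only neighbour of position 0, so the next opponent of [a] has to come from
    there. *)
Lemma opponent_of_first r a : r < 3 -> a \in g (r * k) ->
  exists c j, [/\ j < k, a != c, c \in g (r * k + 1),
    a \in g (r.+1 * k + j) & c \in g (r.+1 * k + j)].
Proof.
move=> r3 a0; have [j jk aj] := plays_in_round a (r3 : r.+1 < 4).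
have [c ac cj] := game_other (index_lt (r3 : r.+1 < 4) jk) aj.
have [i ik ci] := plays_in_round c (ltnW r3).
rewrite -[r * k]addn0 in a0.
have k0 : 0 < k by lia.
have [Ei|//] := opponents_adjacent r3 k0 ik jk ac a0 ci aj cj.
by exists c, j; split=> //; rewrite Ei in ci.
Qed.

(** The two teams of the first game take different opponents from the second game, and so use up
    both of its teams. *)
Lemma second_meets_first r x y i j : r < 3 -> i < k -> j < k -> x != y ->
  x \in g (r * k + 1) -> y \in g (r * k + i) ->
  x \in g (r.+1 * k + j) -> y \in g (r.+1 * k + j) -> i = 0.
Proof.
move=> r3 ik jk xy x1 yi xj yj.
have r4 : r < 4 by lia.
have lt1 : r * k + 1 < 4 * k by apply: index_lt => //; lia.
have lt0 : r * k < 4 * k by lia.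
have [a a0] : exists a, a \in g (r * k).
  by apply/set0Pn; rewrite -card_gt0 card_g.
have [b ab b0] := game_other lt0 a0.
have [c [ja [jak ac c1 aja cja]]] := opponent_of_first r3 a0.
have [d [jb [jbk bd d1 bjb djb]]] := opponent_of_first r3 b0.
(* Otherwise [a] and [b] would share the game of [c] in round [r.+1] and thus meet twice. *)
have cd : c != d.
  apply/eqP=> Ecd; rewrite -{}Ecd in djb.
  have Ej := plays_once (r3 : r.+1 < 4) jak jbk cja djb.
  rewrite -Ej in bjb.
  have := game_determined lt0 (index_lt (r3 : r.+1 < 4) jak) ab a0 b0 aja bjb.
  by clear -k_ge3; lia.
have k0 : 0 < k by clear -k_ge3; lia.
(* Here [w] is [a] or [b]. As [x] plays once in round [r.+1], its opponent [w] there is [y], which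
   therefore had position 0. *)
have meets w l : w \in g (r * k) -> w != x -> l < k ->
    x \in g (r.+1 * k + l) -> w \in g (r.+1 * k + l) -> i = 0.
  move=> w0 wx lk xl wl.
  have El := plays_once (r3 : r.+1 < 4) jk lk xj xl; rewrite -El in wl.
  have Eg := game_eq2 (index_lt (r3 : r.+1 < 4) jk) xy xj yj.
  move: wl; rewrite Eg !inE (negbTE wx) => /eqP Ew; rewrite Ew -[r * k]addn0 in w0.
  exact: plays_once r4 ik k0 yi w0.
move: (x1); rewrite (game_eq2 lt1 cd c1 d1) !inE => /orP[]/eqP Ex.
  by apply: (meets a ja); rewrite ?Ex.
by apply: (meets b jb); rewrite ?Ex.
Qed.

Definition leading r := g (r * k) :|: g (r * k + 1).

Lemma leadingE r x i : i < 2 -> x \in g (r * k + i) -> x \in leading r.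
Proof.
by case: i => [|[|//]] _; rewrite ?addn0 inE => ->; rewrite ?orbT.
Qed.

Lemma leading_mono r : r < 3 -> leading r.+1 \subset leading r.
Proof.
move=> r3; have r4 : r < 4 by lia.
have k0 : 0 < k by lia.
have k1 : 1 < k by lia.
apply/subsetP=> x; rewrite inE => /orP[x0|x1].
  have [i ik xi] := plays_in_round x r4.
  rewrite -[r.+1 * k]addn0 in x0.
  exact: leadingE (moves_forward_one r3 ik k0 xi x0) xi.
have [i ik xi] := plays_in_round x r4.
have i2 : i <= 2 by exact: (moves_forward_one r3 ik k1 xi x1).
have [i1|i1] := ltnP i 2; first by apply: leadingE xi.
(* Position 2 is impossible: the opponent [y] cannot come from position 3, so it comes from position
   1, and then [second_meets_first] puts [x] at position 0. *)
have {i1 i2} Ei : i = 2 by lia.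
have [y xy y1] := game_other (index_lt (r3 : r.+1 < 4) k1) x1.
have [j jk yj] := plays_in_round y r4.
have j2 : j <= 2 by exact: (moves_forward_one r3 jk k1 yj y1).
have Ej : j = 1.
  by case: (opponents_adjacent r3 ik jk k1 xy xi yj x1 y1); lia.
rewrite Ej in yj; rewrite eq_sym in xy.
by have := second_meets_first r3 ik k1 xy yj xi y1 x1; rewrite Ei.
Qed.

Lemma leading_sub0 r : r < 4 -> leading r \subset leading 0.
Proof.
elim: r => [//|r IH] r4; apply: subset_trans (leading_mono _) (IH _); lia.
Qed.

Lemma no_four_rounds : False.
Proof.
(* [h] lists the first two games of each of the four rounds. *)
pose h (p : 'I_4 * 'I_2) := g (p.1 * k + p.2).
have lt_h (p : 'I_4 * 'I_2) : p.1 * k + p.2 < 4 * k.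
  by apply: index_lt => //; have := ltn_ord p.2; lia.
have h_inj : injective h.
  move=> [r i] [r' i'] /g_inj -/(_ (lt_h (r, i)) (lt_h (r', i'))) /= E.
  have i2 := ltn_ord i; have i'2 := ltn_ord i'.
  have Er : r = r' :> nat by nia.
  congr (_, _); apply: val_inj => //=; rewrite Er in E; lia.
have : h @: setT \subset [set A : {set T} | A \subset leading 0 & #|A| == 2].
  apply/subsetP=> _ /imsetP[[r i] _ ->]; rewrite inE card_g ?lt_h // eqxx andbT.
  apply: subset_trans (leading_sub0 (ltn_ord r)).
  by apply/subsetP=> x; apply: leadingE.
(* Eight distinct pairs would lie in a set of at most four teams, which has at most 6 pairs. *)
move/subset_leq_card; rewrite card_imset // cardsT card_prod !card_ord cards_draws.
suff /(leq_bin2l 2) H : #|leading 0| <= 4 by move/leq_trans/(_ H).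
rewrite /leading cardsU !card_g ?leq_subr //; lia.
Qed.

End FourRounds.

(** * Counting games and waiting times in a schedule *)

Section Schedules.

Variables (n : nat) (s : seq {set 'I_n}).

Local Notation game := (nth set0 s).

Lemma games_playedS t x : t < size s ->
  games_played s t.+1 x = games_played s t x + (x \in game t).
Proof.
by move=> ts; rewrite /games_played (take_nth set0 ts) -cats1 count_cat /= addn0.
Qed.

Lemma games_played_mono t u x : t <= u <= size s ->
  games_played s t x <= games_played s u x.
Proof.
case/andP=> tu; rewrite -(subnK tu); elim: (u - t) => [//|d IH] us.
by rewrite addSn games_playedS // (leq_trans (IH (ltnW us))) ?leq_addr.
Qed.

Lemma games_played_gt t u x : t <= u <= size s ->
  games_played s t x < games_played s u x ->
  exists2 i, t <= i < u & x \in game i.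
Proof.
case/andP=> tu; rewrite -(subnK tu); elim: (u - t) => [|d IH] us.
  by rewrite ltnn.
rewrite addSn games_playedS //; case: (boolP (x \in game (d + t))) => [xd _|_].
  by exists (d + t) => //; lia.
by rewrite addn0 => /(IH (ltnW us))[i ti xi]; exists i => //; lia.
Qed.

(** In the reversed list, the games after [i] come first and do not involve [x]; the search stops at
    game [i], before the imaginary game at the end. *)
Lemma rest_before_last x i j : i < j <= size s -> x \in game i ->
  (forall l, i < l < j -> x \notin game l) ->
  rest_before s j x = j - i.+1.
Proof.
case/andP=> ij js xi xl; rewrite /rest_before rev_cons -cats1 find_cat.
have Es : take j s = take i s ++ game i :: drop i.+1 (take j s).
  have it : i < size (take j s) by rewrite size_takel.
  by rewrite -{1}(cat_take_drop i (take j s)) (drop_nth set0 it) nth_take //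
    take_takel // ltnW.
have Hh : has (fun A : {set 'I_n} => x \in A) (rev (take j s)).
  by rewrite has_rev Es has_cat /= xi orbT.
rewrite Hh Es rev_cat rev_cons -cats1 -catA find_cat has_rev.
case: ifP => [/(has_nthP set0)[l]|_]; last first.
  by rewrite /= xi addn0 size_rev size_drop size_takel.
rewrite size_drop size_takel // => lj; rewrite nth_drop nth_take; last by lia.
by move=> H; have := xl (i.+1 + l); rewrite H => /(_ ltac:(lia)).
Qed.

Hypothesis sched : is_schedule s.

Lemma size_schedule : size s = 'C(n, 2).
Proof.
have [us ms] := sched; rewrite -(card_uniqP us) -[in RHS](card_ord n) -card_draws.
by apply: eq_card => A; rewrite ms inE.
Qed.

Lemma card_game t : t < size s -> #|game t| = 2.
Proof. by have [_ ms] := sched => ts; apply/eqP; rewrite -ms mem_nth. Qed.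

Lemma sum_games_played t : t <= size s -> \sum_x games_played s t x = 2 * t.
Proof.
elim: t => [|t IH] ts; first by rewrite big1 // => x _; rewrite /games_played take0.
under eq_bigr => x _ do rewrite games_playedS //.
rewrite big_split /= (IH (ltnW ts)) -big_mkcond /= sum1_card card_game //; lia.
Qed.

(** The counts have average [r]. If one were below [r], all would be at most [r] and their sum too
    small; symmetrically for one above [r]. *)
Lemma games_played_round k r x : n = 2 * k ->
  games_played_differ_at_most s 1 -> r * k <= size s ->
  games_played s (r * k) x = r.
Proof.
move=> nk diff rs; have close y z := diff _ y z rs.
have sum_eq : \sum_y games_played s (r * k) y = \sum_(y < n) r.
  by rewrite sum_games_played // sum_nat_const card_ord nk; lia.
have [lt_r|gt_r|//] := ltngtP (games_played s (r * k) x) r.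
  suff : \sum_y games_played s (r * k) y < \sum_(y < n) r.
    by rewrite sum_eq ltnn.
  rewrite (bigD1 x) //= [in X in _ < X](bigD1 x) //= -addSn.
  by apply: leq_add => //; apply: leq_sum => y _; have := close x y; lia.
suff : \sum_(y < n) r < \sum_y games_played s (r * k) y.
  by rewrite sum_eq ltnn.
rewrite (bigD1 x) //= [in X in _ < X](bigD1 x) //= -addSn.
by apply: leq_add => //; apply: leq_sum => y _; have := close x y; lia.
Qed.

End Schedules.

Theorem theorem3p3 (n k : nat) (hn : n = 2 * k) (hn6 : 6 <= n) :
  ~ exists s : seq {set 'I_n},
      [/\ is_schedule s,
          guaranteed_rest_time s (k - 2),
          games_played_difference_index s 1
        & rest_difference_index s 1].
Proof.
case=> s [sched [rest _] [played _] [rdiff _]].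
have k3 : 3 <= k by lia.
(* There are [k * (2 * k - 1)] games, and [2 * k - 1] is at least 4. *)
have size_ge : 4 * k <= size s.
  rewrite (size_schedule sched) hn bin2 mul2n -doubleMl doubleK; nia.
have round_le r : r < 4 -> r.+1 * k <= size s.
  by move=> r4; apply: leq_trans size_ge; rewrite leq_mul2r r4 orbT.
have lt_idx r i : r < 4 -> i < k -> r * k + i < size s.
  by move=> r4 ik; have := round_le r r4; lia.
have played_round r x : r <= 4 -> games_played s (r * k) x = r.
  by move=> r4; apply: games_played_round; rewrite // (leq_trans _ size_ge) // leq_mul2r r4 orbT.
have once r x i j : r < 4 -> i < k -> j < k ->
    x \in nth set0 s (r * k + i) -> x \in nth set0 s (r * k + j) -> i = j.
  wlog ij : i j / i < j.
    move=> H r4 ik jk xi xj; have [ij|ji|//] := ltngtP i j; first exact: H.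
    by apply/esym/H.
  move=> r4 ik jk xi xj; have r_le := round_le r r4.
  have Hi := games_playedS x (lt_idx _ _ r4 ik).
  have Hj := games_playedS x (lt_idx _ _ r4 jk).
  have mono t u := @games_played_mono _ s t u x.
  (* Over the round the count of [x] rises from [r] to [r.+1] only, but two games at [i < j] would
     raise it by 2. *)
  have H1 := mono (r * k) (r * k + i) ltac:(lia).
  have H2 := mono (r * k + i).+1 (r * k + j) ltac:(lia).
  have H3 := mono (r * k + j).+1 (r.+1 * k) ltac:(lia).
  rewrite (played_round _ _ (ltnW r4)) in H1; rewrite (played_round _ _ r4) in H3.
  by rewrite xi in Hi; rewrite xj in Hj; lia.
have wait r x i j : r < 3 -> i < k -> j < k ->
    x \in nth set0 s (r * k + i) -> x \in nth set0 s (r.+1 * k + j) ->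
    rest_before s (r.+1 * k + j) x = k + j - i.+1.
  move=> r3 ik jk xi xj.
  rewrite (@rest_before_last _ s x (r * k + i)) //; first lia.
    by have := lt_idx _ _ (r3 : r.+1 < 4) jk; lia.
  (* A game of [x] strictly in between would be its second one in round [r] or in round [r.+1]. *)
  move=> l /andP[il lj]; apply/negP=> xl; have [lr|rl] := ltnP l (r.+1 * k).
    have El : l = r * k + (l - r * k) by lia.
    rewrite El in xl.
    have : i = l - r * k by apply: (once r x) => //; lia.
    lia.
  have El : l = r.+1 * k + (l - r.+1 * k) by lia.
  rewrite El in xl.
  have : j = l - r.+1 * k by apply: (once r.+1 x) => //; lia.
  lia.
apply: (@no_four_rounds _ k (nth set0 s)) => //.
- by move=> t tk; apply: card_game => //; apply: leq_trans size_ge.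
- have [us _] := sched; move=> t u tk uk /eqP.
  by rewrite nth_uniq ?(leq_trans _ size_ge) // => /eqP.
- move=> r x r4; have r_le := round_le r r4.
  have [|i Hi xi] := @games_played_gt _ s (r * k) (r.+1 * k) x ltac:(lia).
    by rewrite !played_round // ltnW.
  by exists (i - r * k); [lia | rewrite subnKC //; lia].
- move=> r x i j r3 ik jk xi xj.
  (* Only [k + j - i.+1] games lie between the two, and at least [k - 2] of them avoid [x]; hence
     [i <= j.+1]. *)
  have lt_j := lt_idx _ _ (r3 : r.+1 < 4) jk.
  have := rest x _ _ _ xi xj; rewrite lt_j andbT => /(_ ltac:(lia)) Hc.
  have := leq_trans Hc (count_size _ _).
  by rewrite /games_between size_drop size_takel ?(ltnW lt_j) //; lia.
move=> r x y i i' j r3 ik i'k jk xi yi xj yj.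
(* The two waits are [k + j - i.+1] and [k + j - i'.+1], without truncation as [i] and [i'] are
   below [k]; they differ by the distance between [i] and [i']. *)
have := rdiff _ _ _ (lt_idx _ _ (r3 : r.+1 < 4) jk) xj yj.
by rewrite (wait _ _ _ _ r3 ik jk xi xj) (wait _ _ _ _ r3 i'k jk yi yj); lia.
Qed.
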